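(* Consider the edge-averaging process on the cycle with $n$ vertices, with i.i.d.\ initial opinions uniformly distributed on $\{-1,1\}$, and let $\varepsilon\in(0,1/3)$. Then there is $n_\varepsilon$ such that for all $n>n_\varepsilon$, $$\mathbb{E}[\tau_\varepsilon]\ge c\,\frac{\log^2(n)}{\varepsilon^4},$$ where $c>0$ is a universal constant.
   Context: Edge-averaging process: each vertex $v\in V$ carries an opinion $f_t(v)\in\mathbb R$ at each time $t\ge 0$. Each edge carries an independent rate-one Poisson clock (independent of the initial opinions). When the clock of edge $\{u,v\}$ rings at time $t$, both endpoints update to $f_t(u)=f_t(v)=\frac{f_{t-}(u)+f_{t-}(v)}{2}$, where $f_{t-}(u)=\lim_{s\uparrow t}f_s(u)$; other opinions are unchanged. $\mathrm{osc}(f):=\sup_{u,v}|f(u)-f(v)|$ and $\tau_\varepsilon:=\min\{t\ge0:\mathrm{osc}(f_t)\le\varepsilon\}$. *)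

(* Defs.v *)
From HB Require Import structures.
From mathcomp Require Import all_boot all_order all_algebra.
From mathcomp Require Import all_classical all_reals all_analysis.
Set Implicit Arguments. Unset Strict Implicit. Unset Printing Implicit Defensive.
Import Order.TTheory GRing.Theory Num.Theory.
Local Open Scope ring_scope.
Local Open Scope classical_set_scope.

(* ---------- Deterministic dynamics on the cycle with n vertices ----------
   Vertices are 'I_n; edge e : 'I_n is the edge {e, e+1 mod n} (ordS e).
   Ring times: T e k is the time of the k-th ring (k = 0,1,...) of the clock of
   edge e.  Rings are processed in chronological order (ties, a null event,
   are broken arbitrarily). *)

Section Dynamics.
Variables (R : realType) (n : nat).

Definition avg_edge (g : 'I_n -> R) (e : 'I_n) : 'I_n -> R :=
  fun w => if (w == e) || (w == ordS e) then (g e + g (ordS e)) / 2 else g w.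

(* state = (number of rings of each clock already processed, opinions, time) *)
Definition ea_step (T : 'I_n -> nat -> R)
    (st : ('I_n -> nat) * ('I_n -> R) * R) : ('I_n -> nat) * ('I_n -> R) * R :=
  let: (c, g, s) := st in
  match [pick e | [forall e', T e (c e) <= T e' (c e')]] with
  | Some e => (fun e' => if e' == e then (c e).+1 else c e', avg_edge g e, T e (c e))
  | None => st
  end.

Definition ea_state (T : 'I_n -> nat -> R) (x : 'I_n -> R) (j : nat) :=
  iter j (ea_step T) (fun _ => 0%N, x, 0).

(* time of the j-th ring overall (0 for j = 0) and opinions just after it *)
Definition jump_time T x j : R := (ea_state T x j).2.
Definition jump_opinions T x j : 'I_n -> R := (ea_state T x j).1.2.

Definition jump_index T x (t : R) : nat :=
  match pselect (exists j, t < jump_time T x j.+1) with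
  | left H => ex_minn (P := fun j => t < jump_time T x j.+1) H
  | right _ => 0%N
  end.

Definition opinion_at T x (t : R) : 'I_n -> R := jump_opinions T x (jump_index T x t).

Definition osc (g : 'I_n -> R) : R :=
  \big[Num.max/0]_(u : 'I_n) \big[Num.max/0]_(v : 'I_n) `|g u - g v|.

Definition tau_eps T x (eps : R) : \bar R :=
  ereal_inf (EFin @` [set t : R | 0 <= t /\ osc (opinion_at T x t) <= eps]).

(* ring times of rate-one Poisson clocks from interarrival times *)
Definition ring_time (W : 'I_n -> nat -> R) (e : 'I_n) (k : nat) : R :=
  \sum_(i < k.+1) W e i.

End Dynamics.

Definition mutual_indep d (Omega : measurableType d) (R : realType)
    (P : probability Omega R) (I : eqType) (Y : I -> Omega -> R) : Prop :=
  forall (J : seq I) (B : I -> set R), uniq J ->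
    (forall j, j \in J -> measurable (B j)) ->
    P (\big[setI/setT]_(j <- J) (Y j @^-1` B j)) =
      (\big[*%E/1%E]_(j <- J) P (Y j @^-1` B j))%E.

Definition uniform_pm1 d (Omega : measurableType d) (R : realType)
    (P : probability Omega R) (Z : Omega -> R) : Prop :=
  measurable_fun setT Z /\
  P [set w | Z w = 1] = (2^-1)%:E /\ P [set w | Z w = -1] = (2^-1)%:E.

Definition exp1_distributed d (Omega : measurableType d) (R : realType)
    (P : probability Omega R) (Z : Omega -> R) : Prop :=
  measurable_fun setT Z /\
  forall s : R, 0 <= s -> P [set w | s < Z w] = (expR (- s))%:E.

Definition all_vars (R : realType) (Omega : Type) (n : nat)
    (X : 'I_n -> Omega -> R) (W : 'I_n -> nat -> Omega -> R)
    (i : 'I_n + ('I_n * nat)) : Omega -> R :=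
  match i with inl v => X v | inr ek => W ek.1 ek.2 end.

(* Main.v *)
Require Import Defs.
From HB Require Import structures.
From mathcomp Require Import all_boot all_order all_algebra.
From mathcomp Require Import all_classical all_reals all_analysis.
From mathcomp Require Import ring lra zify.
Import Order.TTheory GRing.Theory Num.Theory.
Local Open Scope ring_scope.
Local Open Scope classical_set_scope.
Set Implicit Arguments. Unset Strict Implicit. Unset Printing Implicit Defensive.

(* Cut the cycle into blocks of length l ~ log n / eps^2.  Some block of initial
   opinions has mean of order eps, and its excess needs time of order l^2 to
   diffuse away.

   Diffusion is bounded pathwise.  A step on an edge changes a linear functional
   <w, f> by (grad w)(grad f) / 2 and releases the energy (grad f)^2 / 2, so by
   Cauchy-Schwarz <w, f> moves little as long as no edge rings more than
   K ~ l^2 times.  This needs only an upper bound on the number of rings of each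
   clock, not the Markov property of the Poisson processes.

   Biased blocks are found for each fixed sequence of averaged edges, by a
   second moment argument: plant in a uniformly chosen block independent signs
   of mean 3 eps.  Chebyshev's inequality makes the oscillation exceed eps with
   probability at least 1/2 under the planted law, and the density of the
   planted law has second moment at most 2, since (1 + 9 eps^2)^l is at most the
   number of blocks.  As opinions and clocks are independent, and finitely many
   rings matter, the bound for fixed sequences passes to the process. *)

(** * Averaging along a fixed sequence of edges: linear functionals, energy and oscillation *)

Section Averaging.
Variables (R : realType) (n : nat).
Implicit Types (f g h w : 'I_n -> R) (e u v : 'I_n) (s : seq 'I_n).

Definition dot f g : R := \sum_u f u * g u.
Definition run g s : 'I_n -> R := foldl (@avg_edge R n) g s.

Lemma dotC f g : dot f g = dot g f.
Proof. by apply: eq_bigr => u _; rewrite mulrC. Qed.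

Lemma dot_ge0 f : 0 <= dot f f.
Proof. by apply: sumr_ge0 => u _; rewrite -expr2 sqr_ge0. Qed.

Lemma avg_edgel g e : avg_edge g e e = (g e + g (ordS e)) / 2.
Proof. by rewrite /avg_edge eqxx. Qed.

Lemma avg_edger g e : avg_edge g e (ordS e) = (g e + g (ordS e)) / 2.
Proof. by rewrite /avg_edge eqxx orbT. Qed.

Lemma avg_edge_other g e u : u != e -> u != ordS e -> avg_edge g e u = g u.
Proof. by rewrite /avg_edge => /negbTE -> /negbTE ->. Qed.

Lemma dot_avg_edge w g e :
  dot w (avg_edge g e) =
  dot w g - (w e - w (ordS e)) * (g e - g (ordS e)) / 2.
Proof.
(* For [n = 1] the edge is a loop and averaging changes nothing. *)
rewrite /dot; have [ee|ne] := eqVneq (ordS e) e.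
  rewrite ee subrr mul0r mul0r subr0; apply: eq_bigr => u _; congr (_ * _).
  have [->|ue] := eqVneq u e; last by rewrite avg_edge_other// ee.
  by rewrite avg_edgel ee; lra.
rewrite (bigD1 e)//= (bigD1 (ordS e))//= [in RHS](bigD1 e)//=.
rewrite [in RHS](bigD1 (ordS e))//=.
under eq_bigr => u /andP[ue uSe] do rewrite avg_edge_other//.
by rewrite avg_edgel avg_edger; lra.
Qed.

Lemma dot_avg_edge_sym f g e : dot (avg_edge f e) g = dot f (avg_edge g e).
Proof. by rewrite dotC !dot_avg_edge (dotC g f); lra. Qed.

Lemma avg_edge_energy g e :
  dot (avg_edge g e) (avg_edge g e) = dot g g - (g e - g (ordS e)) ^+ 2 / 2.
Proof.
rewrite dot_avg_edge avg_edgel avg_edger subrr !mul0r subr0.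
by rewrite dotC dot_avg_edge expr2.
Qed.

Lemma run_cat g s1 s2 : run g (s1 ++ s2) = run (run g s1) s2.
Proof. exact: foldl_cat. Qed.

(** Each averaging step is self-adjoint. Hence a functional of the final opinions is a functional of
    the initial ones, with weights averaged in reverse order. *)
Lemma dot_run_sym f g s : dot (run f (rev s)) g = dot f (run g s).
Proof.
elim: s g => //= e s IHs g.
by rewrite rev_cons -cats1 run_cat /= dot_avg_edge_sym IHs.
Qed.

Lemma run_energy g s : dot (run g s) (run g s) <= dot g g.
Proof.
elim: s g => //= e s IHs g; apply: le_trans (IHs _) _.
by rewrite avg_edge_energy lerBlDr lerDl divr_ge0// sqr_ge0.
Qed.

Lemma run_sum g s : \sum_u run g s u = \sum_u g u.
Proof.
have E f : \sum_u f u = dot (fun=> 1) f by apply: eq_bigr => u _; rewrite mul1r.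
elim: s g => //= e s IHs g.
by rewrite IHs !E dot_avg_edge subrr mul0r mul0r subr0.
Qed.

(* The energy released by a step pays, by AM-GM, for the change of the linear
   functional [dot w]. *)
Lemma avg_edge_dot_ge w g e (b : R) : 0 < b ->
  dot w g - b * dot g g - (w e - w (ordS e)) ^+ 2 / (8 * b) <=
  dot w (avg_edge g e) - b * dot (avg_edge g e) (avg_edge g e).
Proof.
move=> b0; rewrite dot_avg_edge avg_edge_energy.
set p := w e - _; set q := g e - _; set A := dot w g; set B := dot g g.
rewrite -subr_ge0.
have -> : A - p * q / 2 - b * (B - q ^+ 2 / 2) - (A - b * B - p ^+ 2 / (8 * b)) =
  (p - 2 * b * q) ^+ 2 / (8 * b) by field; lra.
by rewrite divr_ge0 ?sqr_ge0// mulr_ge0// ltW.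
Qed.

(** The one-step bounds are summed and the energy left at the end is dropped. The parameter [b]
    balances the two losses and is fixed later. *)
Lemma run_dot_ge w g s (b : R) : 0 < b ->
  dot w g - b * dot g g - (\sum_(e <- s) (w e - w (ordS e)) ^+ 2) / (8 * b) <=
  dot w (run g s).
Proof.
move=> b0.
suff H : dot w g - b * dot g g - (\sum_(e <- s) (w e - w (ordS e)) ^+ 2) / (8 * b)
  <= dot w (run g s) - b * dot (run g s) (run g s).
  by apply: le_trans H _; rewrite gerBl mulr_ge0 ?dot_ge0// ltW.
elim: s g => [|e s IHs] g; first by rewrite big_nil mul0r subr0.
rewrite big_cons /=; apply: le_trans (IHs _).
have := avg_edge_dot_ge w g e b0; rewrite (mulrDl _ _ (8 * b)^-1).
lra.
Qed.

Lemma sum_seq_count (F : 'I_n -> R) (K : nat) s : (forall e, 0 <= F e) ->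
  (forall e, (count_mem e s <= K)%N) ->
  \sum_(e <- s) F e <= K%:R * \sum_e F e.
Proof.
move=> F0 sK.
have -> : \sum_(e <- s) F e = \sum_e (count_mem e s)%:R * F e.
  elim: s {sK} => [|a s IHs].
    by rewrite big_nil big1// => e _; rewrite mul0r.
  rewrite big_cons IHs (bigD1 a)//= [RHS](bigD1 a)//= eqxx natrD mulrDl mul1r.
  rewrite addrA; congr (_ + _); apply: eq_bigr => e.
  by rewrite eq_sym => /negbTE ->.
rewrite mulr_sumr; apply: ler_sum => e _.
by rewrite ler_wpM2r// ler_nat.
Qed.

Lemma osc_ge g u v : `|g u - g v| <= osc g.
Proof.
rewrite /osc; apply: le_trans (le_bigmax _ _ u).
exact: (le_bigmax 0 (fun v => `|g u - g v|)).
Qed.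

Lemma osc_le g (M : R) : 0 <= M -> (forall u v, g u - g v <= M) -> osc g <= M.
Proof.
move=> M0 H; rewrite /osc; apply: bigmax_le => // u _; apply: bigmax_le => // v _.
by rewrite ler_norml H andbT lerNl opprB H.
Qed.

Lemma osc_ge0 g : 0 <= osc g.
Proof. exact: bigmax_ge_id. Qed.

Lemma osc_avg_edge g e : osc (avg_edge g e) <= osc g.
Proof.
apply: osc_le => [|u v]; first exact: osc_ge0.
have H a b : g a - g b <= osc g by apply: le_trans (osc_ge g a b); exact: ler_norm.
rewrite /avg_edge; case: ifP => _; case: ifP => _.
- by rewrite subrr osc_ge0.
- by have := H e v; have := H (ordS e) v; lra.
- by have := H u e; have := H u (ordS e); lra.
- exact: H.
Qed.

Lemma osc_run g s : osc (run g s) <= osc g.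
Proof. by elim: s g => //= e s IHs g; exact: le_trans (IHs _) (osc_avg_edge _ _). Qed.

(** Each value exceeds the average of [g] by at most [osc g]; this is summed against [w]. *)
Lemma dot_le_osc w g : (0 < n)%N -> (forall u, 0 <= w u) ->
  dot w g - (\sum_u w u) / n%:R * \sum_u g u <= (\sum_u w u) * osc g.
Proof.
move=> n0 w0.
have nR : (0 : R) < n%:R by rewrite ltr0n.
have H u : g u - (\sum_v g v) / n%:R <= osc g.
  rewrite lerBlDr -lerBlDl ler_pdivlMr// mulr_natr -[X in _ *+ X]card_ord -sumr_const.
  apply: ler_sum => v _; rewrite lerBlDl -lerBlDr.
  by apply: le_trans (osc_ge g u v); exact: ler_norm.
rewrite -mulrA (mulrC n%:R^-1) [leRHS]mulr_suml [X in _ - X]mulr_suml -sumrB.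
apply: ler_sum => u _; rewrite -mulrBr ler_wpM2l//.
Qed.

End Averaging.

(** * The process as averaging along the sequence of rings *)

Section RingSequence.
Variables (R : realType) (n : nat).
Hypothesis n_gt0 : (0 < n)%N.
Implicit Types (T : 'I_n -> nat -> R) (x : 'I_n -> R) (c : 'I_n -> nat).

(** The same [pick] as in [ea_step], so that ties are broken in the same way. *)
Definition next_ring T c : option 'I_n :=
  [pick e | [forall e', T e (c e) <= T e' (c e')]].

(** The counters of the state are recovered as multiplicities, so the sequence is a function of the
    clocks alone. Its independence of the initial opinions rests on this. *)
Fixpoint ring_seq T (j : nat) : seq 'I_n :=
  if j is j'.+1 then
    let s := ring_seq T j' in
    if next_ring T (fun e => count_mem e s) is Some e then rcons s e else s
  else [::].

Lemma next_ring_some T c : exists e, next_ring T c = Some e.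
Proof.
rewrite /next_ring; case: pickP => [e _|no]; first by exists e.
have [e _ emin] := @arg_minP _ _ _ (Ordinal n_gt0) xpredT (fun e => T e (c e)) isT.
have := no e; suff -> : [forall e', T e (c e) <= T e' (c e')] by [].
by apply/forallP => e'; exact: emin.
Qed.

Lemma ring_seqS T j : exists e, ring_seq T j.+1 = rcons (ring_seq T j) e.
Proof.
have [e he] := next_ring_some T (fun e => count_mem e (ring_seq T j)).
by exists e; rewrite /= he.
Qed.

Lemma size_ring_seq T j : size (ring_seq T j) = j.
Proof.
elim: j => // j IHj; have [e ->] := ring_seqS T j.
by rewrite size_rcons IHj.
Qed.

Lemma take_ring_seq T i j : (i <= j)%N -> take i (ring_seq T j) = ring_seq T i.
Proof.
elim: j => [|j IHj]; first by rewrite leqn0 => /eqP ->.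
rewrite leq_eqVlt => /predU1P[->|]; first by rewrite take_oversize// size_ring_seq.
rewrite ltnS => ij; have [e ->] := ring_seqS T j.
by rewrite -cats1 takel_cat ?size_ring_seq// IHj.
Qed.

Lemma ea_state_ring_seq T x j :
  (ea_state T x j).1 =
  (fun e => count_mem e (ring_seq T j), run x (ring_seq T j)).
Proof.
elim: j => // j; rewrite /ea_state iterS.
case: (iter _ _ _) => -[c g] t /= [-> ->].
rewrite -/(next_ring T (fun e => count_mem e (ring_seq T j))).
case: next_ring => [e|//] /=; congr pair.
  apply/funext => e'; rewrite -cats1 count_cat /= addn0 eq_sym.
  by case: eqP => [->|_]; rewrite ?addn1 ?addn0.
by rewrite -cats1 run_cat.
Qed.

Lemma jump_timeS T x j e : ring_seq T j.+1 = rcons (ring_seq T j) e ->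
  jump_time T x j.+1 = T e (count_mem e (ring_seq T j)).
Proof.
rewrite /jump_time /ea_state iterS -/(ea_state T x j).
have := ea_state_ring_seq T x j; case: ea_state => -[c g] t /= [-> _].
rewrite -/(next_ring T (fun e => count_mem e (ring_seq T j))).
have [e' ->] := next_ring_some T (fun e => count_mem e (ring_seq T j)).
by move=> /rcons_inj[->].
Qed.

(** Ring [K] of an edge, counted from 0, comes after [t], so it is not among the rings up to [t]. *)
Lemma count_ring_seq_le T x (t : R) (K : nat) j :
  (forall e, t < T e K) -> (forall i, (i < j)%N -> jump_time T x i.+1 <= t) ->
  forall e, (count_mem e (ring_seq T j) <= K)%N.
Proof.
move=> tK; elim: j => // j IHj jt e.
have {}IHj := IHj (fun i ij => jt i (ltnW ij)).
have [e' E] := ring_seqS T j; rewrite E -cats1 count_cat /= addn0.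
have [e'e|_] := eqVneq e' e; last by rewrite addn0.
rewrite addn1 ltn_neqAle IHj andbT; apply/eqP => ceK.
have := jt j (ltnSn _); rewrite (jump_timeS x E) e'e ceK.
by rewrite leNgt tK.
Qed.

Lemma sum_count (s : seq 'I_n) : (\sum_e count_mem e s = size s)%N.
Proof.
elim: s => /= [|a s IHs]; first by rewrite big1.
rewrite big_split /= IHs (bigD1 a)//= eqxx big1 ?addn0// => e.
by rewrite eq_sym => /negbTE ->.
Qed.

Lemma opinion_at_run T x (t : R) (K : nat) : (forall e, t < T e K) ->
  exists j, [/\ (j <= n * K)%N, opinion_at T x t = run x (ring_seq T j)
    & forall e, (count_mem e (ring_seq T j) <= K)%N].
Proof.
move=> tK.
have size_le j : (forall i, (i < j)%N -> jump_time T x i.+1 <= t) -> (j <= n * K)%N.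
  move=> /(count_ring_seq_le tK) cK.
  rewrite -(size_ring_seq T j) -sum_count -[n in X in (_ <= X)%N]card_ord -sum_nat_const.
  exact: leq_sum.
have before j : jump_index T x t = j -> forall i, (i < j)%N -> jump_time T x i.+1 <= t.
  (* In the default case the index is 0 and there is no earlier ring to check. *)
  rewrite /jump_index; case: pselect => [H|_ <-//].
  case: ex_minnP => m _ mmin <- i im; rewrite leNgt; apply/negP => /mmin.
  by rewrite leqNgt im.
exists (jump_index T x t); split.
- exact: size_le (before _ erefl).
- by rewrite /opinion_at /jump_opinions ea_state_ring_seq.
- exact: count_ring_seq_le tK (before _ erefl).
Qed.

(** Reduces the hitting time to prefixes of one sequence of fixed length [N]: before [t] there are
    at most [n * K] rings, at most [K] of them on each edge. *)
Lemma tau_eps_ge T x (t eps : R) (K N : nat) : (forall e, t < T e K) -> (n * K <= N)%N ->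
  (forall j, (j <= N)%N -> (forall e, (count_mem e (take j (ring_seq T N)) <= K)%N) ->
    eps < osc (run x (take j (ring_seq T N)))) ->
  (t%:E <= tau_eps T x eps)%E.
Proof.
move=> tK NK H; apply: le_ereal_inf_tmp => _ [r /= [r0 hr]] <-.
rewrite lee_fin leNgt; apply/negP => rt.
have rK e : r < T e K by exact: lt_trans (tK e).
have [j [jK oE cK]] := opinion_at_run x rK.
have jN : (j <= N)%N := leq_trans jK NK.
have := H j jN; rewrite take_ring_seq// => /(_ cK).
by rewrite -oE ltNge hr.
Qed.

End RingSequence.

(** * Independent signs with prescribed means, and the second moment argument *)

Section Tilt.
Variables (R : realType) (I : finType).
Implicit Types (t y : I -> R) (x : {ffun I -> bool}).

Definition sg (b : bool) : R := if b then 1 else -1.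

(* Density, with respect to uniform signs, of independent signs with means t. *)
Definition tilt t x : R := \prod_u (1 + t u * sg (x u)).

Lemma sum_prod_bool (F : I -> bool -> R) :
  \sum_(x : {ffun I -> bool}) \prod_u F u (x u) = \prod_u (F u true + F u false).
Proof.
rewrite -(bigA_distr_bigA F); apply: eq_bigr => u _.
by rewrite big_bool.
Qed.

Lemma sum_tilt t : \sum_x tilt t x = 2 ^+ #|I|.
Proof.
rewrite (sum_prod_bool (fun u b => 1 + t u * sg b)) -prodr_const.
by apply: eq_bigr => u _; rewrite /sg; lra.
Qed.

(** The sum factors over sites. Tilts with disjoint supports are therefore uncorrelated, and
    [t' = t] gives the second moment of the density. *)
Lemma sum_tiltM t t' :
  \sum_x tilt t x * tilt t' x = 2 ^+ #|I| * \prod_u (1 + t u * t' u).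
Proof.
rewrite (eq_bigr (fun x : {ffun I -> bool} =>
  \prod_u ((1 + t u * sg (x u)) * (1 + t' u * sg (x u))))); last first.
  by move=> x _; rewrite -big_split.
rewrite (sum_prod_bool (fun u b => (1 + t u * sg b) * (1 + t' u * sg b))).
rewrite -prodr_const -big_split; apply: eq_bigr => u _.
by rewrite /sg /=; lra.
Qed.

Lemma tilt_cov t u v : \sum_x tilt t x * ((sg (x u) - t u) * (sg (x v) - t v)) =
  if u == v then 2 ^+ #|I| * (1 - t u ^+ 2) else 0.
Proof.
(* A centred sign as a product over all sites, trivial off [u], so that the sum factors. *)
pose c u w (b : bool) := if w == u then sg b - t u else 1.
have cE z x : sg (x z) - t z = \prod_w c z w (x w).
  rewrite (bigD1 z)//= /c eqxx big1 ?mulr1// => w /negbTE ->//.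
rewrite (eq_bigr (fun x : {ffun I -> bool} =>
  \prod_w ((1 + t w * sg (x w)) * (c u w (x w) * c v w (x w))))); last first.
  by move=> x _; rewrite !cE -!big_split.
rewrite (sum_prod_bool (fun w b => (1 + t w * sg b) * (c u w b * c v w b))).
rewrite (bigD1 u)//= {1 2 3 4}/c eqxx; case: eqP => [->|_]; last first.
  rewrite /sg; apply/eqP; rewrite mulf_eq0; apply/orP; left; apply/eqP; ring.
have -> : 2 ^+ #|I| = 2 * \prod_(w | w != v) 2 :> R.
  by rewrite -prodr_const (bigD1 v).
set p := (X in _ * X = _); have -> : p = \prod_(w | w != v) 2.
  by apply: eq_bigr => w wv; rewrite /c (negbTE wv) /sg; ring.
by rewrite /sg; ring.
Qed.

(** Covariances vanish off the diagonal, and each variance [1 - t u ^+ 2] is at most 1. *)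
Lemma tilt_variance t y :
  \sum_x tilt t x * (\sum_u y u * (sg (x u) - t u)) ^+ 2
  <= 2 ^+ #|I| * \sum_u y u ^+ 2.
Proof.
have -> : \sum_x tilt t x * (\sum_u y u * (sg (x u) - t u)) ^+ 2 =
   \sum_u \sum_v y u * y v *
      (\sum_x tilt t x * ((sg (x u) - t u) * (sg (x v) - t v))).
  under [RHS]eq_bigr => u _ do under eq_bigr => v _ do rewrite mulr_sumr.
  under [RHS]eq_bigr => u _ do rewrite exchange_big.
  rewrite [RHS]exchange_big; apply: eq_bigr => x _.
  rewrite expr2 big_distrlr /= mulr_sumr; apply: eq_bigr => u _.
  by rewrite mulr_sumr; apply: eq_bigr => v _; ring.
rewrite mulr_sumr; apply: ler_sum => u _.
under eq_bigr do rewrite tilt_cov.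
rewrite (bigD1 u)//= [X in _ + X]big1 ?addr0 => [|v]; last first.
  by rewrite eq_sym => /negbTE ->; rewrite mulr0.
rewrite eqxx -expr2 mulrCA ler_wpM2l ?exprn_ge0//.
by rewrite ler_piMr ?sqr_ge0// gerBl sqr_ge0.
Qed.

Lemma tilt_ge0 t x : (forall u, 0 <= t u <= 1) -> 0 <= tilt t x.
Proof.
move=> t01; apply: prodr_ge0 => u _; have := t01 u.
by rewrite /sg; case: ifP => _; lra.
Qed.

(** Chebyshev's inequality: on this event the sum lies at least [a] below its mean, while its
    variance is at most [a ^+ 2 / 2]. *)
Lemma tilt_tail t y (a : R) : (forall u, 0 <= t u <= 1) -> 0 < a ->
  2 * a <= \sum_u y u * t u -> \sum_u y u ^+ 2 <= a ^+ 2 / 2 ->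
  \sum_(x : {ffun I -> bool} | \sum_u y u * sg (x u) <= a) tilt t x <= 2 ^+ #|I| / 2.
Proof.
move=> t01 a0 mean var.
have a20 : 0 < a ^+ 2 by rewrite exprn_gt0.
rewrite -(ler_pM2r a20).
apply: (@le_trans _ _ (\sum_x tilt t x * (\sum_u y u * (sg (x u) - t u)) ^+ 2)).
  rewrite mulr_suml [leRHS](bigID (fun x : {ffun I -> bool} => \sum_u y u * sg (x u) <= a))/=.
  rewrite -[leLHS]addr0; apply: lerD; last first.
    by apply: sumr_ge0 => x _; rewrite mulr_ge0 ?tilt_ge0// sqr_ge0.
  apply: ler_sum => x xa; rewrite ler_wpM2l ?tilt_ge0//.
  under eq_bigr do rewrite mulrBr.
  rewrite sumrB -[leRHS]sqrrN lerXn2r ?nnegrE; try lra.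
apply: le_trans (tilt_variance _ _) _.
by rewrite -mulrA ler_wpM2l ?exprn_ge0// (mulrC 2^-1).
Qed.

(* Planting: under the mixture of the m tilted laws the event D has mass at
   least 1/2, and the mixture has density with second moment at most 2. *)
Lemma planted_card m (t y : 'I_m -> I -> R) (a : R) (D : {set {ffun I -> bool}}) :
  (0 < m)%N -> 0 < a ->
  (forall i u, 0 <= t i u <= 1) ->
  (forall i j u, i != j -> t i u * t j u = 0) ->
  (forall i, \prod_u (1 + t i u ^+ 2) <= m%:R) ->
  (forall i, 2 * a <= \sum_u y i u * t i u) ->
  (forall i, \sum_u y i u ^+ 2 <= a ^+ 2 / 2) ->
  (forall i (x : {ffun I -> bool}), a < \sum_u y i u * sg (x u) -> x \in D) ->
  2 ^+ #|I| <= 8 * #|D|%:R :> R.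
Proof.
move=> m0 a0 t01 tt tm mean var yD.
have N0 : 0 < 2 ^+ #|I| :> R by rewrite exprn_gt0.
have [N NE] : exists N, N = 2 ^+ #|I| :> R by eexists.
rewrite -NE in N0 *.
have mR : (0 : R) < m%:R by rewrite ltr0n.
have sumC (c : R) : \sum_(j < m) c = c * m%:R.
  by rewrite sumr_const card_ord mulr_natr.
pose Z x := \sum_i tilt (t i) x.
have sZ : \sum_x Z x = m%:R * N.
  rewrite exchange_big /=; under eq_bigr do rewrite sum_tilt -NE.
  by rewrite sumr_const card_ord mulr_natl.
(* The [m] diagonal terms are at most [N * m] each; off the diagonal the supports are disjoint and
   each term is [N]. *)
have sZ2 : \sum_x Z x ^+ 2 <= 2 * N * m%:R ^+ 2.
  rewrite (eq_bigr (fun x => \sum_i \sum_j tilt (t i) x * tilt (t j) x)); last first.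
    by move=> x _; rewrite expr2 big_distrlr.
  rewrite exchange_big /=; under eq_bigr do rewrite exchange_big /=.
  apply: (@le_trans _ _ (\sum_(i < m) (N * m%:R + \sum_(j < m) N))).
    apply: ler_sum => i _; rewrite (bigD1 i)//= sum_tiltM -NE lerD//.
      rewrite ler_pM2l// -[leRHS]/(m%:R); apply: le_trans (tm i).
      by rewrite le_eqVlt; apply/orP; left; apply/eqP; apply: eq_bigr => u _; rewrite expr2.
    rewrite [leRHS](bigD1 i)//= -[leLHS]add0r; apply: lerD; first exact: ltW.
    apply: ler_sum => j ji; rewrite sum_tiltM -NE big1 ?mulr1// => u _.
    by rewrite tt ?addr0// eq_sym.
  by rewrite big_split /= !sumC; rewrite le_eqVlt; apply/orP; left; apply/eqP; ring.
have sZD : \sum_(x | x \notin D) Z x <= m%:R * N / 2.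
  rewrite exchange_big /=.
  apply: (@le_trans _ _ (\sum_(i < m) (N / 2))); last first.
    by rewrite sumC mulrC mulrA.
  apply: ler_sum => i _; rewrite NE; apply: le_trans (tilt_tail (t01 i) a0 (mean i) (var i)).
  rewrite [leRHS](bigID [pred x | x \notin D])/= -[leLHS]addr0 lerD//.
    rewrite le_eqVlt; apply/orP; left; apply/eqP; apply: eq_bigl => x.
    case: (boolP (x \in D)); rewrite ?andbF// => xD.
    by rewrite andbT leNgt; apply/esym/negP => /yD; apply/negP.
  by apply: sumr_ge0 => x _; exact: tilt_ge0.
(* AM-GM in place of Cauchy-Schwarz. As [Z] has mass at least [m * N / 2] on [D], it yields
   [m * N / 2 <= m * N / 4 + 2 * m * #|D|]. *)
have : \sum_(x in D) Z x <= \sum_(x in D) (Z x ^+ 2 / (8 * m%:R) + 2 * m%:R).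
  apply: ler_sum => x _; rewrite -subr_ge0.
  have -> : Z x ^+ 2 / (8 * m%:R) + 2 * m%:R - Z x =
    (Z x - 4 * m%:R) ^+ 2 / (8 * m%:R) by field; lra.
  by rewrite divr_ge0 ?sqr_ge0// mulr_ge0// ltW.
rewrite big_split /= -mulr_suml sumr_const -mulr_natr => ZD.
have sZ2D : \sum_(x in D) Z x ^+ 2 <= 2 * N * m%:R ^+ 2.
  apply: le_trans sZ2; rewrite [leRHS](bigID (mem D))/= lerDl.
  by apply: sumr_ge0 => x _; exact: sqr_ge0.
have : \sum_(x in D) Z x ^+ 2 / (8 * m%:R) <= N * m%:R / 4.
  rewrite -mulr_suml ler_pdivrMr ?mulr_gt0//; apply: le_trans sZ2D _.
  by rewrite le_eqVlt; apply/orP; left; apply/eqP; field.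
rewrite -mulr_suml => ZD2.
move: sZ; rewrite (bigID (mem D))/= => sZ.
rewrite -(ler_pM2l mR); lra.
Qed.

End Tilt.

(** * Parabolic test functions on blocks of the cycle *)

Section Blocks.
Variables (R : realType) (n l : nat).
Hypotheses (l_gt0 : (0 < l)%N).
Implicit Types (i : 'I_(n %/ l)) (u : 'I_n).

(** A discrete parabola vanishing at both ends of a block. Its sum and its Dirichlet energy are both
    of order [l ^ 3], which fits the time scale [l ^ 2]. *)
Definition parab (j : nat) : R := j%:R * (l%:R - j%:R).
Definition bump i u : R := if (u %/ l == i)%N then parab (u %% l) else 0.

(** Only full blocks are indexed: the vertices left over have quotient [n %/ l] and belong to none.
    Vertex [j] of block [i] is [i * l + j]. *)
Lemma sum_block i (F : nat -> R) :
  \sum_(u < n) (if (u %/ l == i)%N then F (u %% l)%N else 0) = \sum_(j < l) F j.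
Proof.
have ln (j : 'I_l) : (i * l + j < n)%N.
  have := ltn_ord i; have := ltn_ord j; have := leq_trunc_div n l.
  move=> h1 h2 h3; apply: leq_trans h1; apply: (@leq_trans (i.+1 * l)).
    by rewrite mulSn addnC ltn_add2r.
  by rewrite leq_mul2r h3 orbT.
rewrite -big_mkcond (reindex_onto (fun j => Ordinal (ln j))
  (fun u => Ordinal (ltn_pmod u l_gt0))) /=; last first.
  by move=> u /eqP ui; apply: val_inj => /=; rewrite -ui -divn_eq.
apply: eq_big => [j|j _].
  have -> : ((i * l + j) %/ l = i)%N by rewrite divnMDl// (divn_small (ltn_ord j)) addn0.
  by rewrite eqxx /=; apply/eqP/val_inj; rewrite /= modnMDl modn_small.
by rewrite modnMDl modn_small.
Qed.

Lemma sum_parab : \sum_(j < l) parab j = (l%:R ^+ 3 - l%:R) / 6.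
Proof.
have H k : \sum_(j < k) parab j =
    l%:R * (k%:R * (k%:R - 1) / 2) - k%:R * (k%:R - 1) * (2 * k%:R - 1) / 6.
  elim: k => [|k IHk]; first by rewrite big_ord0; ring.
  by rewrite big_ord_recr /= IHk /parab -[k.+1]addn1 natrD; field.
by rewrite H; field.
Qed.

Lemma parab_ge0 j : (j < l)%N -> 0 <= parab j.
Proof. by move=> jl; rewrite mulr_ge0// subr_ge0 ler_nat ltnW. Qed.

Lemma parab_le j : (j < l)%N -> parab j <= l%:R ^+ 2.
Proof.
move=> jl; rewrite expr2 ler_pM//; first by rewrite subr_ge0 ler_nat ltnW.
- by rewrite ler_nat ltnW.
- by rewrite gerBl.
Qed.

Lemma bump_ge0 i u : 0 <= bump i u.
Proof. by rewrite /bump; case: ifP => // _; rewrite parab_ge0// ltn_mod. Qed.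

Lemma sum_bump i : \sum_u bump i u = (l%:R ^+ 3 - l%:R) / 6.
Proof. by rewrite (sum_block i parab) sum_parab. Qed.

Lemma dot_bump i : dot (bump i) (bump i) <= l%:R ^+ 5.
Proof.
rewrite /dot (eq_bigr (fun u : 'I_n => if (u %/ l == i)%N
    then (parab (u %% l)%N) ^+ 2 else 0)); last first.
  by move=> u _; rewrite /bump; case: ifP; rewrite ?mulr0// expr2.
rewrite (sum_block i (fun j => parab j ^+ 2)).
apply: (@le_trans _ _ (\sum_(j < l) (l%:R ^+ 2) ^+ 2)).
  by apply: ler_sum => j _; rewrite lerXn2r ?nnegrE ?exprn_ge0// ?parab_ge0// parab_le.
by rewrite sumr_const card_ord -[_ *+ l]mulr_natl -exprM -exprS.
Qed.

Lemma bump_grad i u :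
  (bump i u - bump i (ordS u)) ^+ 2 <= if (u %/ l == i)%N then l%:R ^+ 2 else 0.
Proof.
have lR : (1 : R) <= l%:R by rewrite ler1n.
(* Either the next vertex starts a block, possibly vertex 0 after going round the cycle, and [u] is
   the last vertex of block [i] if it lies there; or both ends are consecutive in one block. *)
have [[S0 ul]|[Sd Sm jl]] : (ordS u %% l = 0 /\ (u %/ l = i -> u %% l = l.-1) \/
    [/\ ordS u %/ l = u %/ l, ordS u %% l = (u %% l).+1 & (u %% l).+1 < l])%N.
  have un := ltn_ord u; have ul := ltn_pmod u l_gt0; rewrite /=.
  have ue := divn_eq u l.
  have [u1n|u1n] := eqVneq u.+1 n.
    left; rewrite u1n modnn mod0n; split=> // ui.
    have : (i.+1 * l <= n)%N.
      by apply: leq_trans (leq_trunc_div n l); rewrite leq_mul2r ltn_ord orbT.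
    by rewrite mulSn -ui; lia.
  have Sn : (u.+1 < n)%N by lia.
  have [jl|jl] := eqVneq (u %% l).+1 l.
    left; rewrite (modn_small Sn); split; last by move=> _; lia.
    by rewrite -addn1 -modnDml addn1 jl modnn.
  have jl' : ((u %% l).+1 < l)%N by lia.
  right; rewrite (modn_small Sn); split=> //.
    have -> : u.+1 = (u %/ l * l + (u %% l).+1)%N by lia.
    by rewrite divnMDl// (divn_small jl') addn0.
  by rewrite -addn1 -modnDml addn1 modn_small.
  have -> : bump i (ordS u) = 0.
    by rewrite /bump; case: ifP => // _; rewrite S0 /parab mul0r.
  rewrite subr0 /bump; case: eqP => [/ul ->|_]; last by rewrite expr0n.
  rewrite lerXn2r ?nnegrE ?parab_ge0 ?ler0n//; first by rewrite prednK.
  rewrite /parab -[X in _ * (X%:R - _)](prednK l_gt0) -addn1 natrD addrAC subrr add0r mulr1.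
  by rewrite ler_nat leq_pred.
rewrite /bump Sd Sm; case: ifP => _; last by rewrite subrr expr0n.
set j := (u %% l)%N in jl *.
have -> : parab j - parab j.+1 = 2 * j%:R + 1 - l%:R.
  by rewrite /parab -addn1 natrD; ring.
rewrite -[leLHS]real_normK ?num_real// lerXn2r ?nnegrE//.
have : (j.+1)%:R <= l%:R :> R by rewrite ler_nat ltnW.
rewrite -addn1 natrD => jlR; have j0 : 0 <= j%:R :> R by [].
by rewrite ler_norml; apply/andP; split; lra.
Qed.

Lemma sum_bump_grad i :
  \sum_u (bump i u - bump i (ordS u)) ^+ 2 <= l%:R ^+ 3.
Proof.
apply: le_trans (ler_sum _ (fun u _ => bump_grad i u)) _.
by rewrite (sum_block i (fun=> l%:R ^+ 2)) sumr_const card_ord -[_ *+ l]mulr_natl -exprS.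
Qed.

End Blocks.

(** * Planting a biased block for a fixed sequence of edges *)

Section PlantedBlocks.
Variables (R : realType) (n l K : nat) (eps : R) (s : seq 'I_n).
Hypotheses (eps_gt0 : 0 < eps) (eps_lt : eps < 3^-1).
Hypotheses (l_gt1 : (1 < l)%N) (l12 : (12 * l <= n)%N).
Hypotheses (Kl : (512 * K <= l ^ 2)%N) (l_eps : 128 <= eps ^+ 2 * l%:R).
Hypothesis sK : forall e, (count_mem e s <= K)%N.

Let l_gt0 : (0 < l)%N := ltnW l_gt1.
Let mass : R := (l%:R ^+ 3 - l%:R) / 6.

Let l2 : 2 <= l%:R :> R. Proof. by rewrite (ler_nat R 2). Qed.

Let massE : l%:R ^+ 3 / 8 <= mass.
Proof.
rewrite /mass -subr_ge0.
have -> : (l%:R ^+ 3 - l%:R) / 6 - l%:R ^+ 3 / 8 = l%:R * (l%:R ^+ 2 - 2 ^+ 2) / 24 :> R by field.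
rewrite divr_ge0// mulr_ge0// subr_ge0 lerXn2r ?nnegrE//.
Qed.

Let l3_gt0 : 0 < l%:R ^+ 3 :> R. Proof. by rewrite exprn_gt0// ltr0n. Qed.

Let mass_gt0 : 0 < mass.
Proof. by apply: lt_le_trans massE; rewrite divr_gt0. Qed.

(** As [eps < 3^-1], [3 * eps] is a possible mean of a sign. Of the factor 3, one unit is left for
    diffusion and centring and one for the Chebyshev deviation. *)
Definition block_tilt (i : 'I_(n %/ l)) (u : 'I_n) : R :=
  if (u %/ l == i)%N then 3 * eps else 0.

(** The bump minus its average, carried back to the start: paired with the initial signs it gives
    the weighted excess of the final opinions over the global average. *)
Definition block_weight (i : 'I_(n %/ l)) : 'I_n -> R :=
  run (fun u => bump R i u - mass / n%:R) (rev s).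

Let KlR : 512 * K%:R <= l%:R ^+ 2 :> R.
Proof. by move: Kl; rewrite -(ler_nat R) natrM natrX. Qed.

Let n_gt0 : (0 < n)%N. Proof. by apply: leq_trans l12; rewrite muln_gt0. Qed.

Lemma dot_block_weight i (x : 'I_n -> R) :
  dot (block_weight i) x = dot (bump R i) (run x s) - mass / n%:R * \sum_u x u.
Proof.
rewrite dot_run_sym -(run_sum x s) mulr_sumr -sumrB.
by apply: eq_bigr => u _; rewrite mulrBl.
Qed.

(** Averaging does not increase the energy, so the left side is at most [l ^ 5]. The right side is
    at least [eps ^ 2 * l ^ 6 / 128], and [l_eps] compares the two. *)
Lemma block_weight_energy i :
  \sum_u block_weight i u ^+ 2 <= (eps * mass) ^+ 2 / 2.
Proof.
rewrite (eq_bigr (fun u => block_weight i u * block_weight i u)); last by move=> u _; rewrite expr2.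
apply: le_trans (run_energy _ _) _.
have nR : (0 : R) < n%:R by rewrite ltr0n.
have -> : dot (fun u => bump R i u - mass / n%:R) (fun u => bump R i u - mass / n%:R) =
    dot (bump R i) (bump R i) - mass ^+ 2 / n%:R.
  rewrite /dot (eq_bigr (fun u => bump R i u * bump R i u +
     (- 2 * mass / n%:R * bump R i u + (mass / n%:R) ^+ 2))); last by move=> u _; ring.
  rewrite !big_split /= -mulr_sumr (sum_bump R l_gt0) -/mass sumr_const card_ord -[_ *+ n]mulr_natl.
  by field; rewrite gt_eqF.
apply: (@le_trans _ _ (l%:R ^+ 5)).
  apply: le_trans (dot_bump R l_gt0 i); rewrite gerBl divr_ge0 ?sqr_ge0// ltW//.
have h : (l%:R ^+ 3 / 8) ^+ 2 <= mass ^+ 2 :> R.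
  by rewrite lerXn2r ?nnegrE// ltW// divr_gt0.
have e2 : 0 < eps ^+ 2 by rewrite exprn_gt0.
rewrite exprMn ler_pdivlMr//; apply: le_trans (ler_wpM2l (ltW e2) h).
have -> : eps ^+ 2 * (l%:R ^+ 3 / 8) ^+ 2 = (eps ^+ 2 * l%:R) * (l%:R ^+ 5 / 64) by field.
have l5 : 0 < l%:R ^+ 5 / 64 :> R by rewrite divr_gt0// exprn_gt0// ltr0n.
have := ler_wpM2r (ltW l5) l_eps; lra.
Qed.

(** The bump paired with the tilt starts at [3 * eps * mass]. Diffusion takes at most [3 / 4] of
    [eps * mass], and centring at most [1 / 4] of it because [12 * l <= n]. *)
Lemma block_weight_mean i :
  2 * (eps * mass) <= \sum_u block_weight i u * block_tilt i u.
Proof.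
rewrite -/(dot (block_weight i) (block_tilt i)) dot_block_weight.
have sumc (c : R) : \sum_(u < n) (if (u %/ l == i)%N then c else 0) = l%:R * c.
  by rewrite (sum_block l_gt0 i (fun=> c)) sumr_const card_ord -[_ *+ l]mulr_natl.
have E : \sum_u block_tilt i u = l%:R * (3 * eps) by exact: sumc.
have E2 : dot (block_tilt i) (block_tilt i) = l%:R * (3 * eps) ^+ 2.
  rewrite -sumc; apply: eq_bigr => u _; rewrite /block_tilt.
  by case: ifP => _; rewrite ?mulr0// expr2.
have Ew : dot (bump R i) (block_tilt i) = 3 * eps * mass.
  rewrite /mass -(sum_bump R l_gt0 i) mulr_sumr; apply: eq_bigr => u _.
  by rewrite /block_tilt /bump; case: ifP => _; rewrite ?mulr0// mulrC.
(* This [b] balances the two losses in [run_dot_ge]: each is at most [3 * eps * l ^ 3 / 64], as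
   [512 * K <= l ^ 2]. *)
have b0 : 0 < l%:R ^+ 2 / (192 * eps).
  by apply: divr_gt0; [rewrite exprn_gt0// ltr0n|rewrite mulr_gt0].
have := run_dot_ge (bump R i) (block_tilt i) s b0.
rewrite E Ew E2.
have S : \sum_(e <- s) (bump R i e - bump R i (ordS e)) ^+ 2 <= K%:R * l%:R ^+ 3.
  apply: le_trans (sum_seq_count _ sK) _ => [e|]; first exact: sqr_ge0.
  by rewrite ler_wpM2l// sum_bump_grad.
have lne : l%:R != 0 :> R by rewrite gt_eqF// ltr0n.
have ene : eps != 0 by rewrite gt_eqF.
have nne : n%:R != 0 :> R by rewrite gt_eqF// ltr0n.
have -> : l%:R ^+ 2 / (192 * eps) * (l%:R * (3 * eps) ^+ 2) = 3 * eps * (l%:R ^+ 3 / 64).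
  by field.
set S1 := \sum_(e <- s) _ in S *.
have S' : S1 / (8 * (l%:R ^+ 2 / (192 * eps))) <= 3 * eps * (l%:R ^+ 3 / 64).
  have -> : 8 * (l%:R ^+ 2 / (192 * eps)) = l%:R ^+ 2 / (24 * eps) by field.
  rewrite ler_pdivrMr; last by apply: divr_gt0; [rewrite exprn_gt0// ltr0n|rewrite mulr_gt0].
  apply: le_trans S _.
  have -> : 3 * eps * (l%:R ^+ 3 / 64) * (l%:R ^+ 2 / (24 * eps)) =
    l%:R ^+ 2 / 512 * l%:R ^+ 3 :> R.
    by field.
  apply: ler_wpM2r; first exact: ltW.
  by rewrite ler_pdivlMr ?ltr0n// mulrC.
have M : mass / n%:R * (l%:R * (3 * eps)) <= 3 * eps * (mass / 12).
  have -> : mass / n%:R * (l%:R * (3 * eps)) = 3 * eps * mass * (l%:R / n%:R) by field.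
  have -> : 3 * eps * (mass / 12) = 3 * eps * mass * 12^-1 by rewrite mulrA.
  apply: ler_wpM2l; first by apply/ltW/mulr_gt0 => //; apply: mulr_gt0.
  by rewrite ler_pdivrMr ?ltr0n// ler_pdivlMl// -(natrM R 12) ler_nat.
have := ler_wpM2l (ltW eps_gt0) massE.
lra.
Qed.

(** The threshold is [eps * mass]: the bump has total weight [mass], so a weighted excess above it
    forces an oscillation above [eps]. *)
Lemma card_osc_run_gt : (1 + 9 * eps ^+ 2) ^+ l <= (n %/ l)%:R ->
  2 ^+ n <= 8 * #|[set x : {ffun 'I_n -> bool} |
    eps < osc (run (fun u => sg R (x u)) s)]%SET|%:R :> R.
Proof.
move=> lm; rewrite -[n in 2 ^+ n]card_ord.
apply: (@planted_card R _ (n %/ l) block_tilt block_weight (eps * mass)).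
- by rewrite divn_gt0//; apply: leq_trans l12; rewrite leq_pmull.
- exact: mulr_gt0.
- move=> i u; rewrite /block_tilt; case: ifP => _; last by rewrite lexx ler01.
  by rewrite ltW ?mulr_gt0//= -ler_pdivlMl// mulr1 ltW.
- move=> i j u ij; rewrite /block_tilt; case: eqP => [ui|_]; last by rewrite mul0r.
  by case: eqP => [uj|_]; rewrite ?mulr0//; case/eqP: ij; apply: val_inj; rewrite /= -ui -uj.
- move=> i; apply: le_trans lm.
  rewrite (eq_bigr (fun u : 'I_n => if (u %/ l == i)%N then 1 + 9 * eps ^+ 2 else 1)); last first.
    by move=> u _; rewrite /block_tilt; case: ifP => _; ring.
  rewrite -big_mkcond /= prodr_const.
  have -> : #|[pred u : 'I_n | (u %/ l == i)%N]| = l; last by [].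
  (* The size of the block, read off from the sum of the constant 1 over it. *)
  have := @sum_block R n l l_gt0 i (fun=> 1).
  by rewrite -big_mkcond /= !sumr_const card_ord => /eqP; rewrite eqr_nat => /eqP.
- exact: block_weight_mean.
- exact: block_weight_energy.
- move=> i x; rewrite -/(dot (block_weight i) (fun u => sg R (x u))) dot_block_weight.
  rewrite -(run_sum _ s) => H; rewrite inE.
  have := dot_le_osc (run (fun u => sg R (x u)) s) n_gt0 (bump_ge0 R l_gt0 i).
  rewrite (sum_bump R l_gt0) -/mass => /(lt_le_trans H).
  by rewrite mulrC ltr_pM2l.
Qed.

End PlantedBlocks.

(** * Measurability and integration facts *)

Section MeasureFacts.
Context d (Omega : measurableType d) (R : realType).

Lemma measure_bigsetU_le (mu : {measure set Omega -> \bar R}) (I : Type) (r : seq I)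
    (F : I -> set Omega) : (forall i, measurable (F i)) ->
  (mu (\big[setU/set0]_(i <- r) F i) <= \sum_(i <- r) mu (F i))%E.
Proof.
move=> mF; elim: r => [|i r IHr]; first by rewrite !big_nil measure0.
have mr : measurable (\big[setU/set0]_(j <- r) F j) by exact: bigsetU_measurable.
rewrite !big_cons; apply: le_trans (measureU2 mu (mF i) mr) _.
exact: leeD.
Qed.

Lemma measure_bigsetU_disjoint (mu : {measure set Omega -> \bar R}) (I : choiceType) (r : seq I)
    (F : I -> set Omega) : (forall i, measurable (F i)) -> uniq r ->
  (forall i j w, F i w -> F j w -> i = j) ->
  mu (\big[setU/set0]_(i <- r) F i) = (\sum_(i <- r) mu (F i))%E.
Proof.
move=> mF + FI; elim: r => [|i r IHr]; first by rewrite !big_nil measure0.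
move=> /andP[ir ur].
have mr : measurable (\big[setU/set0]_(j <- r) F j) by exact: bigsetU_measurable.
rewrite !big_cons -IHr//; apply: measureU => //.
rewrite -bigcup_seq -subset0 => w [Fi [j /= jr Fj]].
by rewrite (FI _ _ _ Fi Fj) jr in ir.
Qed.

(** The integral of a nonnegative function is a supremum over the simple functions below it, so a
    pointwise comparison of [f] with [t] times the indicator of [A] suffices. *)
Lemma ge0_ge_integral_measurable (mu : {measure set Omega -> \bar R}) (A : set Omega)
    (f : Omega -> \bar R) (t : R) : measurable A -> 0 <= t ->
  (forall w, (0 <= f w)%E) -> (forall w, A w -> (t%:E <= f w)%E) ->
  (t%:E * mu A <= \int[mu]_w f w)%E.
Proof.
move=> mA t0 f0 tf.
have -> : (t%:E * mu A)%E = (\int[mu]_w (t * \1_A w)%:E)%E.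
  rewrite (integralZl_indic _ (fun=> A))//= ?integral_indic ?setIT//.
  by move/(le_lt_trans t0); rewrite ltxx.
rewrite !ge0_integralTE//; last by move=> w; rewrite lee_fin mulr_ge0.
apply: ereal_sup_le => _ [h /= hA <-]; exists h => //= w.
apply: le_trans (hA w) _; rewrite indicE.
have [wA|_] := boolP (w \in A); last by rewrite mulr0.
by rewrite mulr1 tf//; rewrite inE in wA.
Qed.

Lemma measurable_finbool (I : finType) (b : I -> Omega -> bool) (Q : {ffun I -> bool} -> Prop) :
  (forall i, measurable [set w | b i w]) ->
  measurable [set w | Q [ffun i => b i w]].
Proof.
move=> mb.
have -> : [set w | Q [ffun i => b i w]] =
    \bigcup_(f in [set f | Q f]) \bigcap_(i in [set: I]) [set w | b i w = f i].
  apply/seteqP; split=> w /=.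
    by move=> Qw; exists [ffun i => b i w] => // i _; rewrite /= ffunE.
  move=> [f Qf bf]; suff -> : [ffun i => b i w] = f by [].
  by apply/ffunP => i; rewrite ffunE bf.
apply: fin_bigcup_measurable => [|f _]; first exact: finite_finset.
apply: fin_bigcap_measurable => [|i _]; first exact: finite_finset.
case: (f i); first exact: mb.
rewrite (_ : [set w | _] = ~` [set w | b i w]); first exact: measurableC.
by apply/seteqP; split=> w /=; case: (b i w).
Qed.

(** Given the first rings, the next one is decided by finitely many comparisons of ring times of
    index below [N]. The sigma-algebra is arbitrary, so that the one generated by the clocks can be
    used. *)
Lemma measurable_ring_seq (n N : nat) (T : Omega -> 'I_n -> nat -> R) : (0 < n)%N ->
  (forall e k, (k < N)%N -> measurable_fun setT (fun w => T w e k)) ->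
  forall j s, (j <= N)%N -> measurable [set w | ring_seq (T w) j = s].
Proof.
move=> n0 mT; elim=> [|j IHj] s jN.
  have [->|s0] := eqVneq s [::].
    by rewrite (_ : [set w | _] = setT); [exact: measurableT|apply/seteqP; split].
  rewrite (_ : [set w | _] = set0)//; apply/seteqP; split=> w //= sE.
  by rewrite -sE eqxx in s0.
have [js|js] := eqVneq (size s) j.+1; last first.
  rewrite (_ : [set w | _] = set0)//; apply/seteqP; split=> // w sE.
  by rewrite -(sE : ring_seq (T w) j.+1 = s) size_ring_seq// eqxx in js.
case/lastP: s js => // s e; rewrite size_rcons => -[js].
pose c e := count_mem e s.
rewrite (_ : [set w | _] = [set w | ring_seq (T w) j = s] `&`
    [set w | next_ring (T w) c = Some e]).
  apply: measurableI; first by apply: IHj; exact: ltnW.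
  pose b (p : 'I_n * 'I_n) w := T w p.1 (c p.1) <= T w p.2 (c p.2).
  have mb p : measurable [set w | b p w].
    rewrite -[X in measurable X]setTI; apply: measurable_fun_le => //; apply: mT;
      by apply: leq_ltn_trans (count_size _ _) _; rewrite js.
  rewrite (_ : [set w | _] = [set w |
      [pick e | [forall e', [ffun p => b p w] (e, e')]] = Some e]).
    exact: (measurable_finbool (fun f : {ffun 'I_n * 'I_n -> bool} =>
       [pick e | [forall e', f (e, e')]] = Some e)).
  apply/seteqP; split=> w /= <-; rewrite /next_ring; apply: eq_pick => a /=;
    by apply: eq_forallb => a'; rewrite ffunE.
apply/seteqP; split=> w /=.
  have [a ea] := next_ring_some n0 (T w) (fun e => count_mem e (ring_seq (T w) j)).
  by rewrite ea => /rcons_inj[sE <-]; split=> //; rewrite -ea /c sE.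
by move=> [sE]; rewrite sE => ->.
Qed.

End MeasureFacts.

(** * Independence of generated sigma-algebras, and a tail bound for ring times *)

Section Independence.
Context d (Omega : measurableType d) (R : realType) (P : probability Omega R).
Variables (I : choiceType) (Y : I -> Omega -> R).
Hypothesis mY : forall i, measurable_fun setT (Y i).
Hypothesis indepY : mutual_indep P Y.

Definition rect (J : seq I) (B : I -> set R) : set Omega :=
  \bigcap_(j in [set` J]) (Y j @^-1` B j).

(** A pi-system generating the sigma-algebra of the variables indexed by [J]. *)
Definition rects (J : seq I) : set (set Omega) :=
  [set A | exists2 B, (forall i, measurable (B i)) & A = rect J B].

Lemma measurable_preimage i (B : set R) : measurable B -> measurable (Y i @^-1` B).
Proof. by move=> mB; rewrite -[X in measurable X]setTI; exact: mY. Qed.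

Lemma measurable_rect J B : (forall i, measurable (B i)) -> measurable (rect J B).
Proof.
move=> mB; rewrite /rect bigcap_seq; apply: bigsetI_measurable => j _.
exact: measurable_preimage.
Qed.

Lemma prob_rect J B : uniq J -> (forall i, measurable (B i)) ->
  P (rect J B) = (\prod_(j <- J) P (Y j @^-1` B j))%E.
Proof. by move=> uJ mB; rewrite /rect bigcap_seq indepY. Qed.

Lemma rects_setI J : setI_closed (rects J).
Proof.
move=> _ _ [B mB ->] [C mC ->]; exists (fun i => B i `&` C i).
  by move=> i; exact: measurableI.
apply/seteqP; split=> [w [Bw Cw] j jJ|w BCw]; first by split; [exact: Bw|exact: Cw].
by split=> j /BCw[].
Qed.

(** As functions of [E] both sides are finite measures that agree on the pi-system [rects J2], hence
    on what it generates. *)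
Lemma indep_sigma_rects J1 J2 B (E : set Omega) : uniq (J1 ++ J2) ->
  (forall i, measurable (B i)) -> <<s rects J2 >> E ->
  P (E `&` rect J1 B) = (P E * P (rect J1 B))%E.
Proof.
move=> uJ mB sE.
have mC : measurable (rect J1 B) by exact: measurable_rect.
have PC : P (rect J1 B) = (fine (P (rect J1 B)))%:E by rewrite fineK// fin_num_measure.
have r0 : 0 <= fine (P (rect J1 B)) by rewrite fine_ge0.
pose r : {nonneg R} := NngNum r0.
rewrite PC muleC -/(mrestr P mC E) -[RHS]/(mscale r P E).
apply: (g_sigma_algebra_measure_unique (rects J2) _ (fun=> setT)) => //.
- by move=> _ [C mC' ->]; exact: measurable_rect.
- move=> _; exists (fun=> setT) => //; apply/seteqP; split=> // w _ j _ //.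
- by apply/seteqP; split=> // w _; exists 0%N.
- exact: rects_setI.
- move=> _ [C mC' ->]; rewrite /= /mrestr /mscale /= -PC.
  have [uJ1 dJ uJ2] := and3P (etrans (esym (cat_uniq J1 J2)) uJ).
  (* One family of sides serves both rectangles, as [J1] and [J2] are disjoint. *)
  pose D i := if i \in J1 then B i else C i.
  have D2 j : j \in J2 -> D j = C j.
    move=> jJ2; rewrite /D; case: ifP => // jJ1.
    by case/hasP: dJ; exists j.
  have -> : rect J2 C `&` rect J1 B = rect (J1 ++ J2) D.
    apply/seteqP; split=> [w [Cw Bw] j /=|w Dw].
      rewrite mem_cat /D; case: ifP => [jJ1 _|_ /= jJ2]; [exact: Bw|exact: Cw].
    split=> j /= jJ; have /= := Dw j; rewrite mem_cat jJ ?orbT => /(_ isT).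
      by rewrite /preimage /= D2.
    by rewrite /preimage /= /D jJ.
  have mD i : measurable (D i) by rewrite /D; case: ifP.
  rewrite !prob_rect// big_cat /=; congr (_ * _)%E; apply: eq_big_seq => j jJ.
    by rewrite /D jJ.
  by rewrite D2.
- move=> _; rewrite /= /mrestr setTI.
  by rewrite PC ltry.
Qed.

Lemma measurable_rects J j : j \in J ->
  measurable_fun (setT : set (g_sigma_algebraType (rects J))) (Y j).
Proof.
move=> jJ _ B mB; rewrite setTI; apply: sub_sigma_algebra.
exists (fun i => if i == j then B else setT); first by move=> i; case: ifP.
apply/seteqP; split=> [w Bw i _ /=|w /(_ j jJ)]; last by rewrite /= /preimage /= eqxx.
by rewrite /preimage /=; case: eqP => // ->.
Qed.

(** From [1 - exp (- t) <= t]; at [t = 0] it makes nonpositive waiting times a null event. *)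
Lemma exp1_prob_le i (t : R) : exp1_distributed P (Y i) -> 0 <= t ->
  (P (Y i @^-1` `]-oo, t]) <= t%:E)%E.
Proof.
move=> [_ ed] t0.
have -> : Y i @^-1` `]-oo, t] = ~` [set w | t < Y i w].
  by apply/seteqP; split=> w /=; rewrite in_itv /= leNgt => /negP.
rewrite probability_setC; last first.
  rewrite (_ : [set w | _] = Y i @^-1` `]t, +oo[); first exact: measurable_preimage.
  by apply/seteqP; split=> w /=; rewrite in_itv /= andbT.
rewrite ed// -EFinB lee_fin; have := expR_ge1Dx (- t); lra.
Qed.

(* Positive times with sum at most k/32 are at most 1/16 for at least half of
   the indices; a union bound over such sets of indices replaces Chernoff. *)
Lemma sum_exp1_tail k (r : 'I_k -> I) : injective r ->
  (forall i, exp1_distributed P (Y (r i))) ->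
  (P [set w | (\sum_(i < k) Y (r i) w <= k%:R / 32)%R] <= ((2^-1) ^+ k)%:E)%E.
Proof.
move=> r_inj rE.
pose short (J : {set 'I_k}) : set Omega :=
  rect [seq r i | i <- enum J] (fun=> `]-oo, 16^-1]).
pose A : set Omega := \big[setU/set0]_(i <- enum 'I_k) (Y (r i) @^-1` `]-oo, 0]).
pose B : set Omega :=
  \big[setU/set0]_(J <- [seq J : {set 'I_k} <- enum {: {set 'I_k}} | (k <= 2 * #|J|)%N]) short J.
have mA0 i : measurable (Y (r i) @^-1` `]-oo, 0]) by exact: measurable_preimage.
have mS J : measurable (short J) by exact: measurable_rect.
have mA : measurable A by exact: bigsetU_measurable.
have mB : measurable B by exact: bigsetU_measurable.
have PA : P A = 0.
  apply/eqP; rewrite eq_le measure_ge0 andbT.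
  apply: le_trans (measure_bigsetU_le P _ _) _; first exact: mA0.
  by rewrite big1// => i _; apply/eqP; rewrite eq_le measure_ge0 andbT exp1_prob_le.
(* A waiting time is short with probability at most [1 / 16], and [k / 2] of them give [4 ^ -k]; the
   union over at most [2 ^ k] sets leaves [2 ^ -k]. *)
have PS (J : {set 'I_k}) : (k <= 2 * #|J|)%N -> (P (short J) <= ((4^-1) ^+ k)%:E)%E.
  move=> kJ; rewrite prob_rect//; last by rewrite map_inj_uniq// enum_uniq.
  rewrite big_map; apply: (@le_trans _ _ (\prod_(i <- enum J) (16^-1)%:E)%E).
    suff : (0 <= \prod_(i <- enum J) P (Y (r i) @^-1` `]-oo, 16^-1%R])
        <= \prod_(i <- enum J) (16^-1)%:E)%E by case/andP.
    elim/big_ind2: _ => [|a b a' b' /andP[a0 ab] /andP[a0' ab']|i _].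
    - by rewrite lee_fin ler01 lexx.
    - by rewrite mule_ge0//= lee_pmul.
    - by rewrite measure_ge0 exp1_prob_le.
  rewrite prodEFin lee_fin big_enum /= prodr_const.
  have -> : 16^-1 = (4^-1) ^+ 2 :> R by rewrite exprVn; congr (_^-1); ring.
  by rewrite -exprM ler_wiXn2l// invf_le1// ler1n.
have PB : (P B <= ((2^-1) ^+ k)%:E)%E.
  apply: le_trans (measure_bigsetU_le P _ _) _; first exact: mS.
  rewrite big_filter big_enum_cond /=.
  apply: (@le_trans _ _ (\sum_(J : {set 'I_k}) ((4^-1) ^+ k)%:E)%E).
    rewrite [leRHS](bigID [pred J : {set 'I_k} | (k <= 2 * #|J|)%N])/=.
    rewrite -[leLHS]adde0; apply: leeD; last by apply: sume_ge0 => J _; rewrite lee_fin exprn_ge0.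
    by apply: lee_sum => J; exact: PS.
  rewrite sumEFin lee_fin sumr_const -cardsT -powersetT card_powerset cardsT card_ord.
  by rewrite -[_ *+ (2 ^ k)]mulr_natr natrX -exprMn; have -> : 4^-1 * 2 = 2^-1 :> R by field.
have mT : measurable [set w | (\sum_(i < k) Y (r i) w <= k%:R / 32)%R].
  rewrite -[X in measurable X]setTI; apply: measurable_fun_le => //.
  by apply: measurable_sum => i; exact: mY.
apply: le_trans PB; rewrite -[leRHS]add0e -PA.
apply: le_trans (measureU2 _ mA mB).
apply: le_measure; rewrite ?inE//; first exact: measurableU.
move=> w /= sumw; have [?|nA] := pselect (A w); [by left|right].
have Ypos i : 0 < Y (r i) w.
  rewrite ltNge; apply/negP => Yi; apply: nA.
  by rewrite /A -bigcup_seq; exists i; rewrite /= ?mem_enum// in_itv.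
rewrite /B -bigcup_seq; exists [set i | Y (r i) w <= 16^-1]%SET => /=; last first.
  by move=> _ /= /mapP[i + ->]; rewrite mem_enum inE /preimage /= in_itv.
rewrite mem_filter mem_enum andbT -(ler_nat R) natrM.
set J := [set i | _]%SET.
have kJ : k%:R = #|J|%:R + #|~: J|%SET%:R :> R by rewrite -natrD cardsC card_ord.
(* Times outside [J] exceed [1 / 16], so a sum of at most [k / 32] leaves at most half of the
   indices there. *)
suff : #|~: J|%SET%:R / 16 <= \sum_(i < k) Y (r i) w by rewrite kJ in sumw *; lra.
rewrite (bigID (mem J))/= mulr_natl -[leLHS]add0r; apply: lerD.
  by apply: sumr_ge0 => i _; exact: ltW.
rewrite -sumr_const [leLHS](eq_bigl [pred i | i \notin J]) => [|i]; last by rewrite /= inE.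
by apply: ler_sum => i; rewrite !inE -ltNge => /ltW.
Qed.

End Independence.

(** * From fixed sequences to the random process *)

Section ExpectedTime.
Variables (R : realType) (n l K : nat) (eps : R).
Hypotheses (eps_gt0 : 0 < eps) (eps_lt : eps < 3^-1).
Hypotheses (l_gt1 : (1 < l)%N) (l12 : (12 * l <= n)%N).
Hypotheses (Kl : (512 * K <= l ^ 2)%N) (l_eps : 128 <= eps ^+ 2 * l%:R).
Hypothesis lm : (1 + 9 * eps ^+ 2) ^+ l <= (n %/ l)%:R.
Hypothesis Kn : (16 * n <= 2 ^ K.+1)%N.

Let n_gt0 : (0 < n)%N.
Proof. by apply: leq_trans l12; rewrite muln_gt0 /=; exact: ltnW. Qed.

(** A condition on a sequence and signs alone, so that signs can be counted for each sequence
    separately. *)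
Definition late_osc (s : seq 'I_n) (b : {ffun 'I_n -> bool}) : Prop :=
  forall j, (j <= size s)%N -> (forall e, (count_mem e (take j s) <= K)%N) ->
    eps < osc (run (fun u => sg R (b u)) (take j s)).

(** Averaging never increases the oscillation, so the longest prefix with at most [K] rings per edge
    decides. *)
Lemma card_late_osc s : 2 ^+ n <= 8 * #|[pred b | `[< late_osc s b >]]|%:R :> R.
Proof.
pose valid j := (j <= size s)%N && [forall e, (count_mem e (take j s) <= K)%N].
have v0 : exists j, valid j.
  by exists 0%N; rewrite /valid leq0n take0; apply/forallP.
have vub j : valid j -> (j <= size s)%N by case/andP.
case: (ex_maxnP v0 vub) => j /andP[js /forallP jK] jmax.
have := card_osc_run_gt eps_gt0 eps_lt l_gt1 l12 Kl l_eps jK lm.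
move=> /le_trans; apply; rewrite ler_pM2l// ler_nat.
apply: subset_leq_card; apply/fintype.subsetP => b; rewrite !inE => bj.
move=> i si iK.
have ij : (i <= j)%N by apply: jmax; rewrite /valid si; apply/forallP.
apply: lt_le_trans bj _.
by rewrite -(cat_take_drop i (take j s)) run_cat take_takel// osc_run.
Qed.

Variables (d : measure_display) (Omega : measurableType d) (P : probability Omega R).
Variables (X : 'I_n -> Omega -> R) (W : 'I_n -> nat -> Omega -> R).
Hypothesis X_pm1 : forall v, uniform_pm1 P (X v).
Hypothesis W_exp1 : forall e k, exp1_distributed P (W e k).
Hypothesis XW_indep : mutual_indep P (all_vars X W).

Let Y := all_vars X W.
Let T w := ring_time (fun e k => W e k w).
Let N := (n * K)%N.
Let JX : seq ('I_n + 'I_n * nat) := [seq inl v | v <- enum 'I_n].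
(** The first [N] rings are decided by ring times of index below [N], that is, by the first [N]
    waiting times of each clock. *)
Let JW : seq ('I_n + 'I_n * nat) := [seq inr (e, k) | e <- enum 'I_n, k <- iota 0 N].

Let mY i : measurable_fun setT (Y i).
Proof. by case: i => [v|[e k]]; [case: (X_pm1 v)|case: (W_exp1 e k)]. Qed.

Let uniqJ : uniq (JX ++ JW).
Proof.
rewrite cat_uniq map_inj_uniq ?enum_uniq//=; last by move=> ? ? [].
apply/andP; split.
  by apply/hasPn => _ /allpairsP[[e k] [_ _ ->]]; apply/mapP => -[].
apply: allpairs_uniq; rewrite ?enum_uniq ?iota_uniq//.
by move=> [? ?] [? ?] _ _ [-> ->].
Qed.

Let signs (b : {ffun 'I_n -> bool}) : set Omega :=
  rect Y JX (fun i => if i is inl v then [set sg R (b v)] else setT).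

Let signs_meas (b : {ffun 'I_n -> bool}) (i : 'I_n + 'I_n * nat) :
  measurable (if i is inl v then [set sg R (b v)] else setT).
Proof. by case: i. Qed.

Let prob_signs b : P (signs b) = ((2^-1) ^+ n)%:E.
Proof.
rewrite /signs prob_rect//; last by have := uniqJ; rewrite cat_uniq => /and3P[].
rewrite big_map (eq_bigr (fun=> (2^-1)%:E)) => [|v _].
  by rewrite prodEFin big_enum /= prodr_const card_ord.
have [_ [prob1 probN1]] := X_pm1 v.
by rewrite /sg; case: (b v).
Qed.

Let signsE b w : signs b w -> (fun v => X v w) = (fun v => sg R (b v)).
Proof.
move=> bw; apply/funext => v.
by have := bw (inl v); apply; rewrite /= map_f// mem_enum.
Qed.

Let rings (s : N.-tuple 'I_n) : set Omega := [set w | ring_seq (T w) N = s].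

(** Measurability with respect to the clocks alone, as [indep_sigma_rects] demands. *)
Let rings_sigma s : <<s rects Y JW >> (rings s).
Proof.
apply: (@measurable_ring_seq _ (g_sigma_algebraType (rects Y JW)) R n N T n_gt0 _ N s (leqnn _)).
move=> e k kN; apply: measurable_sum => i.
apply: (@measurable_rects _ _ R _ Y JW (inr (e, val i))).
apply/allpairsP; exists (e, val i) => /=; split; rewrite ?mem_enum// mem_iota add0n.
by apply: leq_trans kN.
Qed.

Let rings_meas s : measurable (rings s).
Proof.
apply: (measurable_ring_seq n_gt0 _ s (leqnn N)) => e k _.
by apply: measurable_sum => i; exact: (mY (inr (e, val i))).
Qed.

Let prob_rings_signs s b : P (rings s `&` signs b) = (P (rings s) * ((2^-1) ^+ n)%:E)%E.
Proof. by rewrite -(prob_signs b); apply: (indep_sigma_rects mY XW_indep uniqJ). Qed.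

Let config : finType := (N.-tuple 'I_n * {ffun 'I_n -> bool})%type.

Let late : set Omega :=
  \big[setU/set0]_(p <- [seq p : config <- enum {: config} | `[< late_osc p.1 p.2 >]])
    (rings p.1 `&` signs p.2).

Let late_meas : measurable late.
Proof.
by apply: bigsetU_measurable => p _; apply: measurableI; [|exact: measurable_rect].
Qed.

(** Given the sequence of rings the signs are still uniform, and at least one sign pattern in 8 is
    good. The events [rings s] partition the space. *)
Let prob_late : ((8^-1)%:E <= P late)%E.
Proof.
rewrite /late measure_bigsetU_disjoint; first last.
- move=> [s b] [s' b'] w [/= ws wb] [/= ws' wb']; congr pair.
    by apply: val_inj; exact: etrans (esym ws) ws'.
  apply/ffunP => v; have := congr1 (@^~ v) (etrans (esym (signsE wb)) (signsE wb')).
  by rewrite /= /sg; case: (b v); case: (b' v) => // h; exfalso; lra.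
- by rewrite filter_uniq// enum_uniq.
- by move=> p; apply: measurableI => //; exact: measurable_rect.
rewrite big_filter big_enum_cond /=.
rewrite (eq_bigr (fun p : config => (P (rings p.1) * ((2^-1) ^+ n)%:E)%E)); last first.
  by move=> p _; exact: prob_rings_signs.
rewrite -(pair_big_dep xpredT
    (fun (s : N.-tuple 'I_n) (b : {ffun 'I_n -> bool}) => `[< late_osc s b >])
  (fun (s : N.-tuple 'I_n) (b : {ffun 'I_n -> bool}) => (P (rings s) * ((2^-1) ^+ n)%:E)%E))/=.
apply: (@le_trans _ _ (\sum_(s : N.-tuple 'I_n) (P (rings s) * (8^-1)%:E))%E); last first.
  apply: lee_sum => s _.
  rewrite -ge0_sume_distrr; last by move=> b _; rewrite lee_fin exprn_ge0.
  rewrite lee_wpmul2l// sumEFin lee_fin sumr_const -[_ *+ #|_|]mulr_natr exprVn.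
  rewrite mulrC ler_pdivlMr ?exprn_gt0// ler_pdivrMl//.
  exact: card_late_osc.
rewrite -ge0_sume_distrl// -big_enum /= -measure_bigsetU_disjoint//.
- suff -> : \big[setU/set0]_(s <- enum {: N.-tuple 'I_n}) rings s = setT.
    by rewrite [X in (X * _)%E](probability_setT P) mul1e.
  apply/seteqP; split=> // w _; rewrite -bigcup_seq.
  have sN : size (ring_seq (T w) N) == N by rewrite size_ring_seq.
  by exists (Tuple sN); rewrite //= mem_enum.
- exact: enum_uniq.
- by move=> s s' w ws ws'; apply: val_inj; exact: etrans (esym ws) ws'.
Qed.

(** Rings are indexed from 0, so [T w e K] is a sum of [K.+1] waiting times. *)
Let early : set Omega :=
  \big[setU/set0]_(e <- enum 'I_n) [set w | T w e K <= K.+1%:R / 32].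

Let early_meas1 e : measurable [set w | T w e K <= K.+1%:R / 32].
Proof.
rewrite -[X in measurable X]setTI; apply: measurable_fun_le => //.
by apply: measurable_sum => i; exact: (mY (inr (e, val i))).
Qed.

Let early_meas : measurable early.
Proof. exact: bigsetU_measurable. Qed.

(** A union bound over the [n] clocks, each failing with probability at most [2 ^ -(K.+1)]. *)
Let prob_early : (P early <= (16^-1)%:E)%E.
Proof.
apply: le_trans (measure_bigsetU_le P _ _) _; first exact: early_meas1.
apply: (@le_trans _ _ (\sum_(e <- enum 'I_n) ((2^-1) ^+ K.+1)%:E)%E).
  apply: lee_sum => e _.
  apply: (@sum_exp1_tail _ Omega R P _ Y mY XW_indep K.+1 (fun i => inr (e, val i))).
    by move=> i j [/val_inj].
  by move=> i; exact: W_exp1.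
rewrite big_enum /= sumEFin lee_fin sumr_const card_ord -[_ *+ n]mulr_natr exprVn.
rewrite ler_pdivrMl ?exprn_gt0// ler_pdivlMr// mulrC -natrX -(natrM R 16) ler_nat.
exact: Kn.
Qed.

(** On [late] without [early], of probability at least [1 / 8 - 1 / 16], the hitting time is at
    least [K.+1 / 32]. *)
Lemma expected_tau_ge : ((K.+1%:R / 32 / 16)%:E <=
  \int[P]_w tau_eps (ring_time (fun e k => W e k w)) (fun v => X v w) eps)%E.
Proof.
have t0 : 0 <= K.+1%:R / 32 :> R by rewrite divr_ge0.
have mG : measurable (late `\` early) by exact: measurableD.
have PG : ((16^-1)%:E <= P (late `\` early))%E.
  have : (P late <= P (late `\` early) + P early)%E.
    apply: le_trans (measureU2 P mG early_meas).
    apply: le_measure; rewrite ?inE//; first exact: measurableU.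
    by move=> w wl; have [we|we] := pselect (early w); [right|left].
  move=> /(le_trans prob_late) lateG.
  have {}lateG := le_trans lateG (leeD2l _ prob_early).
  have -> : 16^-1 = 8^-1 - 16^-1 :> R by field.
  by rewrite EFinB leeBlDr.
rewrite EFinM; apply: le_trans (lee_wpmul2l _ PG) _; first by rewrite lee_fin.
apply: ge0_ge_integral_measurable => // [w|w [+ we]].
  by apply: le_ereal_inf_tmp => _ [r [r0 _] <-]; rewrite lee_fin.
rewrite /late -bigcup_seq => -[[s b]]; rewrite /= mem_filter => /andP[/asboolP sb _] [ws wb].
rewrite (signsE wb); apply: (@tau_eps_ge _ _ n_gt0 _ _ _ _ K N) => // [e|j jN].
  rewrite ltNge; apply/negP => eK; apply: we.
  by rewrite /early -bigcup_seq; exists e; rewrite //= mem_enum.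
by rewrite -/(T w) (ws : ring_seq (T w) N = s) => /sb; apply; rewrite size_tuple.
Qed.

End ExpectedTime.

(** * Choice of the block length, and conclusion *)

Lemma expR_ge_sqr (R : realType) (x : R) : 0 <= x -> x ^+ 2 / 4 <= expR x.
Proof.
move=> x0; have -> : expR x = expR (x / 2) ^+ 2.
  by rewrite expr2 -expRD; congr expR; lra.
have -> : x ^+ 2 / 4 = (x / 2) ^+ 2 by field.
have := expR_ge1Dx (x / 2) => h.
by rewrite lerXn2r ?nnegrE ?expR_ge0//; lra.
Qed.

(* The block length l is about ln n / (18 eps^2), so that the likelihood ratio
   of a tilted block has second moment at most sqrt n. *)
Lemma block_length (R : realType) (eps : R) (n : nat) :
  0 < eps -> eps < 3^-1 -> 256 * 512 + 2 / eps ^+ 2 <= ln (n%:R : R) ->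
  exists l : nat, [/\ (1 < l)%N /\ (12 * l <= n)%N, 128 <= eps ^+ 2 * l%:R,
    (1 + 9 * eps ^+ 2) ^+ l <= (n %/ l)%:R,
    (16 * n <= 2 ^ (l ^ 2 %/ 512).+1)%N
    & ln (n%:R : R) / (64 * eps ^+ 2) <= l%:R].
Proof.
move=> eps0 eps3; set e2 := eps ^+ 2; set x := ln _ => xA.
have e20 : 0 < e2 by rewrite exprn_gt0.
have e2n : e2 != 0 by rewrite gt_eqF.
have e29 : e2 <= 9^-1.
  have -> : 9^-1 = (3^-1) ^+ 2 :> R by rewrite exprVn; congr (_^-1); ring.
  by rewrite lerXn2r ?nnegrE ?ltW.
have d0 : 0 < 2 / e2 by rewrite divr_gt0.
have x0 : 256 * 512 <= x by lra.
have xd : 2 / e2 <= x by lra.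
have n0 : 0 < n%:R :> R.
  rewrite ltr0n lt0n; apply/eqP => nE; move: x0.
  by rewrite /x nE ln0//; lra.
have nE : n%:R = expR x by rewrite /x lnK// posrE.
pose y := x / (18 * e2).
have y0 : 0 <= y by apply: divr_ge0; lra.
have ye : e2 * y = x / 18 by rewrite /y; field.
have yx : x / 2 <= y.
  rewrite /y ler_pdivlMr ?mulr_gt0//.
  have : x / 2 * (18 * e2) <= x / 2 * 2 by apply: ler_wpM2l; lra.
  lra.
have /andP[ly yl] := truncn_itv y0; set l := Num.truncn y in ly yl.
rewrite -addn1 natrD in yl.
have l64 : x / (64 * e2) <= l%:R.
  have -> : x / (64 * e2) = y * (18 / 64) by rewrite /y; field.
  lra.
have lR : 0 < l%:R :> R by lra.
have l0 : (0 < l)%N by rewrite -(ltr0n R).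
(* The square root of [n]. Once [2 * l <= z] is known, there are at least [z] blocks. *)
set z := expR (x / 2).
have z2 : n%:R = z ^+ 2 by rewrite nE expr2 -expRD; congr expR; lra.
have zl : 2 * l%:R <= z.
  have := @expR_ge_sqr _ (x / 2); rewrite -/z => h.
  have {}h : x ^+ 2 / 16 <= z by apply: le_trans (h _); lra.
  apply: le_trans h; apply: (@le_trans _ _ (2 * y)); first by rewrite ler_pM2l.
  have -> : 2 * y = x * (2 / e2) / 18 by rewrite /y; field.
  have := @ler_wpM2l R x (ltac:(lra)) _ _ xd; rewrite -expr2.
  have : 0 <= x ^+ 2 by exact: sqr_ge0.
  lra.
have z6 : 6 <= z by apply: le_trans (expR_ge1Dx (x / 2)); lra.
exists l; split=> //.
- split; first by rewrite -(ltr_nat R); lra.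
  rewrite -(ler_nat R) natrM z2.
  apply: (@le_trans _ _ (6 * (2 * l%:R))); first by lra.
  by rewrite expr2; apply: ler_pM => //; lra.
- have : e2 * y <= e2 * (l%:R + 1) by rewrite ler_pM2l// ltW.
  rewrite ye mulrDr mulr1; lra.
- apply: (@le_trans _ _ z).
    (* Together with [18 * e2 * l <= x] this bounds the power by [exp (x / 2)], which is [z]. *)
    have h : 1 + 9 * e2 <= expR (9 * e2) by exact: expR_ge1Dx.
    apply: (@le_trans _ _ (expR (9 * e2) ^+ l)).
      by rewrite lerXn2r// nnegrE ?expR_ge0//; lra.
    rewrite -expRM_natl ler_expR.
    have : e2 * l%:R <= e2 * y by rewrite ler_pM2l.
    rewrite ye mulr_natl -mulr_natr; lra.
  have h : n%:R < (n %/ l).+1%:R * l%:R :> R.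
    by rewrite -natrM ltr_nat ltn_ceil.
  rewrite -addn1 natrD in h.
  suff : (z + 1) * l%:R < ((n %/ l)%:R + 1) * l%:R by rewrite ltr_pM2r// ltrD2r => /ltW.
  apply: le_lt_trans h; rewrite z2.
  apply: (@le_trans _ _ (z * (2 * l%:R))); last by rewrite expr2 ler_pM2l//; lra.
  rewrite mulrA ler_pM2r//; lra.
- rewrite -(ler_nat R) natrM natrX nE.
  (* It then suffices that [15 + x <= k / 2]. Here [k] is at least [x ^ 2 / (64 * 512)], which is at
     least [4 * x] since [x >= 256 * 512]. *)
  have e12 : expR (2^-1) <= 2 :> R.
    have := expR_ge1Dx (- 2^-1 : R); rewrite expRN => h.
    by rewrite -lef_pV2 ?posrE ?expR_gt0//; lra.
  set k := (l ^ 2 %/ 512).+1.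
  have kl : l%:R ^+ 2 <= k%:R * 512 :> R.
    by rewrite -natrX -(natrM R k 512) ler_nat ltnW// ltn_ceil.
  apply: (@le_trans _ _ (expR 2^-1 ^+ k)); last by rewrite lerXn2r ?nnegrE ?expR_ge0.
  have e16 : 16 <= expR 15 :> R by apply: le_trans (expR_ge1Dx 15); lra.
  apply: (@le_trans _ _ (expR (15 + x))).
    by rewrite expRD ler_pM2r ?expR_gt0.
  rewrite -expRM_natl ler_expR.
  have xl : x / 8 <= l%:R by lra.
  have : (x / 8) ^+ 2 <= l%:R ^+ 2 by rewrite lerXn2r ?nnegrE//; lra.
  have -> : (x / 8) ^+ 2 = x * x / 64 by field.
  have := @ler_wpM2l R x (ltac:(lra)) _ _ x0.
  rewrite mulr_natl -mulr_natr; lra.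
Qed.

Theorem theorem5p1 (R : realType) :
  exists c : R, 0 < c /\
  forall eps : R, 0 < eps < 3^-1 ->
  exists n_eps : nat, forall n : nat, (n_eps < n)%N ->
  forall (d : measure_display) (Omega : measurableType d) (P : probability Omega R)
         (X : 'I_n -> Omega -> R) (W : 'I_n -> nat -> Omega -> R),
    (forall v, uniform_pm1 P (X v)) ->
    (forall e k, exp1_distributed P (W e k)) ->
    mutual_indep P (all_vars X W) ->
    ((c * (ln (n%:R : R)) ^+ 2 / eps ^+ 4)%:E <=
      \int[P]_w tau_eps (ring_time (fun e k => W e k w)) (fun v => X v w) eps)%E.
Proof.
(* The expected time is at least [k / 512] with [k >= l ^ 2 / 512], and
   [l >= ln n / (64 * eps ^ 2)]. *)
exists ((512 * 64)^-1 ^+ 2); split.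
  by apply: exprn_gt0; rewrite invr_gt0; apply: mulr_gt0; rewrite ltr0n.
move=> eps /andP[eps0 eps3].
pose A := 256 * 512 + 2 / eps ^+ 2.
exists (Num.truncn (expR A)) => n nA d Omega P X W hX hW hXW.
have An : A <= ln n%:R.
  have h : expR A < n%:R.
    have /andP[_ /lt_le_trans] := truncn_itv (expR_ge0 A); apply.
    by rewrite ler_nat.
  by rewrite -ler_expR lnK ?ltW// posrE (lt_trans _ h)// expR_gt0.
have [l [[l1 l12] le lm Kn nl]] := block_length eps0 eps3 An.
have Kl : (512 * (l ^ 2 %/ 512) <= l ^ 2)%N by rewrite mulnC leq_trunc_div.
apply: le_trans (expected_tau_ge eps0 eps3 l1 l12 Kl le lm Kn hX hW hXW).
rewrite lee_fin; set k := (l ^ 2 %/ 512).+1.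
have kl : l%:R ^+ 2 <= k%:R * 512 :> R.
  by rewrite -natrX -(natrM R k 512) ler_nat ltnW// ltn_ceil.
have x0 : 0 <= ln (n%:R : R).
  have d0 : 0 <= 2 / eps ^+ 2 by rewrite divr_ge0 ?sqr_ge0.
  rewrite /A in An; lra.
have : (ln n%:R / (64 * eps ^+ 2)) ^+ 2 <= l%:R ^+ 2 :> R.
  by rewrite lerXn2r ?nnegrE// divr_ge0// mulr_ge0// sqr_ge0.
have -> : (512 * 64)^-1 ^+ 2 * ln n%:R ^+ 2 / eps ^+ 4 =
    (ln n%:R / (64 * eps ^+ 2)) ^+ 2 / 512 ^+ 2 :> R.
  by field; rewrite gt_eqF.
lra.
Qed.
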